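(* There is a positive measure $\mu$, concentrated on $(-1,1)^\infty$, which satisfies $$\sup_{s\in(-1,1)^\infty,\ d\ge1}\left(\prod_{j=1}^d(1-s_j^2)\int_{(-1,1)^\infty}|K_d(t,s)|^2\,d\mu(t)\right)<\infty$$ but which is not a Carleson measure for $H^2(\mathbb{T}^\infty)$.
   Context: Measures on $(-1,1)^\infty$ (countably infinite product) are Borel measures for the product topology. For $d\in\mathbb{N}$ and $s,t\in(-1,1)^\infty$, $K_d(t,s)=\prod_{j=1}^d\frac{1}{1-t_js_j}$. $H^2(\mathbb{T}^\infty)$ is the Hilbert space of power series $f(z)=\sum_\kappa f_\kappa z^\kappa$, the sum being over finitely supported multi-indices $\kappa=(\kappa_1,\kappa_2,\dots)$ of non-negative integers with $z^\kappa=\prod_jz_j^{\kappa_j}$, with norm $\|f\|^2_{H^2(\mathbb{T}^\infty)}=\sum_\kappa|f_\kappa|^2<\infty$. A finite measure $\mu$ on $\mathbb{D}^\infty$ (in particular on $(-1,1)^\infty$) is a Carleson measure for $H^2(\mathbb{T}^\infty)$ if there is $C>0$ such that $\int|f(z)|^2\,d|\mu|(z)\le C\|f\|^2_{H^2(\mathbb{T}^\infty)}$ for all polynomials $f$ (finite linear combinations of monomials $z^\kappa$). *)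

(* Defs.v *)
From mathcomp Require Import all_boot all_order all_algebra.
From mathcomp Require Import finmap.
From mathcomp Require Import complex.
From mathcomp Require Import all_classical all_reals all_analysis.

Set Implicit Arguments.
Unset Strict Implicit.
Unset Printing Implicit Defensive.

Import Order.TTheory GRing.Theory Num.Theory.
Import numFieldNormedType.Exports.

Local Open Scope classical_set_scope.
Local Open Scope ring_scope.

(* Coordinates are numbered from 0: the t_j of the mathematical text, j >= 1,
   is t (j - 1) here. *)
Definition Rinfty (R : realType) := {ptws nat -> R}.

Definition borel_Rinfty (R : realType) :=
  g_sigma_algebraType (@open (Rinfty R)).

(* (-1,1)^infty, a Borel subset of R^infty: its Borel sets for the product
   topology are the Borel sets of R^infty that it contains, so the measures on
   it are the measures on [borel_Rinfty R] that do not charge its complement. *)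
Definition cube (R : realType) : set (borel_Rinfty R) :=
  [set t | forall j : nat, -1 < t j < 1].

Definition concentrated_on d (T : measurableType d) (R : realType)
    (mu : {measure set T -> \bar R}) (A : set T) :=
  measurable A /\ mu (~` A) = 0%E.

Definition kernel_K (R : realType) (d : nat) (t s : borel_Rinfty R) : R :=
  \prod_(j < d) (1 - t j * s j)^-1.

(* The finitely supported families of non-negative integers. *)
Definition multiindex := {fsfun nat -> nat with 0%N}.

Definition monomial (A : comNzRingType) (z : nat -> A) (kappa : multiindex) : A :=
  \prod_(j <- finsupp kappa) z j ^+ kappa j.

(* The coefficient of z^kappa in [f] is [f kappa]. *)
Definition infpoly (R : realType) := {fsfun multiindex -> R[i] with 0}.

Definition eval_infpoly (R : realType) (f : infpoly R) (z : nat -> R[i]) : R[i] :=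
  \sum_(kappa <- finsupp f) f kappa * monomial z kappa.

Definition modulus (R : realType) (z : R[i]) : R := ComplexField.Normc.normc z.

(* Squared norm of the power series with coefficients [f]; it belongs to
   H^2(T^infty) when this is finite. *)
Definition H2_norm_sq (R : realType) (f : multiindex -> R[i]) : \bar R :=
  (\esum_(kappa in [set: multiindex]) (modulus (f kappa) ^+ 2)%:E)%E.

(* Carleson measures for H^2(T^infty), among the measures concentrated on
   (-1,1)^infty; |mu| = mu as measures are non-negative. *)
Definition is_carleson (R : realType)
    (mu : {finite_measure set (borel_Rinfty R) -> \bar R}) :=
  exists2 C : R, 0 < C & forall f : infpoly R,
    (\int[mu]_(t in @cube R)
        (modulus (eval_infpoly f (fun j => (t j)%:C%C)) ^+ 2)%:E
      <= C%:E * H2_norm_sq f)%E.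

(* Main.v *)
Require Import Defs.
From HB Require Import structures.
From mathcomp Require Import all_boot all_order all_algebra.
From mathcomp Require Import finmap.
From mathcomp Require Import complex.
From mathcomp Require Import all_classical all_reals all_analysis.
From mathcomp Require Import measurable_realfun ring lra.

Set Implicit Arguments.
Unset Strict Implicit.
Unset Printing Implicit Defensive.

Import Order.TTheory GRing.Theory Num.Theory.
Import numFieldNormedType.Exports.

Local Open Scope classical_set_scope.
Local Open Scope ring_scope.

(** The constants of the two conditions multiply over independent coordinates,
    so any gap between them in one variable is amplified by taking products.

    In one variable let p ^ 2 = 1 / 2 and
    nu = (4 / 9) (delta_p + delta_(-p)). The test on reproducing kernels
    [one_variable_kernel_test] holds with the constant 1:
      (1 - s ^ 2) * \int (1 - t s) ^ -2 dnu(t) <= 1    for -1 < s < 1.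
    Yet the polynomial 2 + z ^ 2 takes the value 5 / 2 at both atoms and has
    squared norm 5, while \int (2 + t ^ 2) ^ 2 dnu(t) = 50 / 9 > 5: the embedding
    constant of nu is at least 10 / 9. It exceeds the kernel test constant
    because the embedding is extremal at the sum of the kernels at p and -p,
    which is not a multiple of a single kernel.

    Let nu_n be the product of n copies of nu, extended by the Dirac mass at 0
    in the remaining coordinates. Each nu_n still passes the kernel test with
    the constant 1 ([sign_layer_kernel_test]): a coordinate carrying delta_0
    contributes 1 - s_j ^ 2 <= 1, and a coordinate that the kernel ignores
    contributes the mass 8 / 9 of nu. On the other hand,
    f_n = \prod_(i < n) (2 + z_i ^ 2) gives nu_n an embedding constant of at
    least (10 / 9) ^ n. Hence
      mu = \sum_n (19 / 20) ^ n nu_n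
    passes the kernel test with the constant \sum_n (19 / 20) ^ n = 20
    ([sign_measure_kernel_test]), and is finite for the same reason, but an
    embedding constant C of mu would satisfy
    C >= (19 / 20 * 10 / 9) ^ n = (19 / 18) ^ n for all n
    ([integral_tensor_power_ge], [H2_norm_sq_tensor_power]). *)

(** * Measurability on the cube *)

Section Measurability.
Context (R : realType).

Lemma measurable_coord (D : set (borel_Rinfty R)) (j : nat) :
  measurable_fun D (fun t : borel_Rinfty R => t j).
Proof.
apply: (measurable_funS measurableT (@subsetT _ _)).
apply: (measurability _ (RGenOpens.measurableE R)) => _ [_ [a [b ->] <-]].
rewrite setTI; apply: sub_sigma_algebra.
have cj : continuous (fun t : Rinfty R => t j).
  exact: (@proj_continuous nat (fun=> R : topologicalType) j).
have := iffLR (@continuousP _ _ (fun t : Rinfty R => t j)) cj.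
apply; exact: interval_open.
Qed.

Lemma measurable_cube : measurable (@cube R).
Proof.
have -> : @cube R = \bigcap_j [set t | -1 < (t : borel_Rinfty R) j < 1].
  by apply/seteqP; split=> t /= ht j; [move=> _|]; exact: ht.
apply: bigcap_measurable => [|j _]; first by exists 0%N.
have := @measurable_coord setT j measurableT _ (measurable_itv `]-1, 1[).
by rewrite setTI; congr measurable; apply/seteqP; split=> t /=; rewrite in_itv.
Qed.

Lemma cube_kernel_pos (t s : borel_Rinfty R) j :
  cube t -> cube s -> 0 < 1 - t j * s j.
Proof.
by move=> /(_ j) ht /(_ j) hs; move: (t j) (s j) ht hs => x y *; nra.
Qed.

(** The kernel is a product of inverses, and inversion is discontinuous at 0;
    on the cube the denominators are positive, so that inversion may be replaced
    by the measurable function x |-> x `^ (-1). *)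
Lemma measurable_kernel (d : nat) (s : borel_Rinfty R) :
  cube s -> measurable_fun (@cube R) (fun t => (`|kernel_K d t s| ^+ 2)%:E).
Proof.
move=> cs; apply/measurable_EFinP; apply: measurable_funX.
apply: measurableT_comp => //.
apply: (@eq_measurable_fun _ _ _ _ _
  (fun t : borel_Rinfty R => \prod_(j < d) (1 - t j * s j) `^ (-1))).
  move=> t /set_mem ct; apply: eq_bigr => j _.
  by rewrite powR_inv1// ltW// cube_kernel_pos.
apply: measurable_prod => j _.
apply: (measurableT_comp (f := fun x : R => x `^ (-1))) => //.
apply: measurable_funB => //; apply: measurable_funM => //.
exact: measurable_coord.
Qed.

End Measurability.

(** * The measure *)

Section SignMeasure.
Context (R : realType).

(** The point p of the one-variable measure nu. *)
Definition node : R := Num.sqrt 2^-1.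

Lemma node_sqr : node ^+ 2 = 2^-1.
Proof. by rewrite sqr_sqrtr. Qed.

Lemma node_itv : 0 <= node < 1.
Proof.
rewrite sqrtr_ge0 /= -(@ltr_pXn2r _ 2) ?nnegrE ?sqrtr_ge0 ?ler01//.
by rewrite node_sqr expr1n; lra.
Qed.

(** The atoms of nu_n: the first n coordinates are p or -p according to the
    signs e, the others are 0. *)
Definition sign_point (n : nat) (e : {ffun 'I_n -> bool}) : borel_Rinfty R :=
  fun j => if insub j is Some i then (-1) ^+ e i * node else 0.

Lemma sign_point_lt n (e : {ffun 'I_n -> bool}) (i : 'I_n) :
  sign_point e i = (-1) ^+ e i * node.
Proof. by rewrite /sign_point valK. Qed.

Lemma sign_point_ge n (e : {ffun 'I_n -> bool}) (j : nat) :
  (n <= j)%N -> sign_point e j = 0.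
Proof. by move=> nj; rewrite /sign_point insubF // ltnNge nj. Qed.

Lemma sign_point_cube n (e : {ffun 'I_n -> bool}) : cube (sign_point e).
Proof.
move=> j; have /andP[p0 p1] := node_itv.
rewrite /sign_point; case: insubP => [i _ _|_]; last by rewrite ltrN10 ltr01.
by case: (e i); rewrite ?expr1 ?expr0; lra.
Qed.

(** The atoms of nu_n have mass (4 / 9) ^ n, and 19 / 45 = 19 / 20 * 4 / 9. *)
Lemma weight_ge0 n : 0 <= (19 / 45 : R) ^+ n.
Proof. by apply: exprn_ge0; lra. Qed.

Definition weight n : {nonneg R} := NngNum (weight_ge0 n).

(** The enumeration of the sign vectors turns the layer into a sum indexed by
    integers, as [msum] requires; the default vector is never reached there. *)
Definition sign_atom n (i : nat) : {measure set (borel_Rinfty R) -> \bar R} :=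
  mscale (weight n)
    (\d_(sign_point (nth [ffun=> false] (enum {ffun 'I_n -> bool}) i))).

Definition sign_layer n : {measure set (borel_Rinfty R) -> \bar R} :=
  msum (sign_atom n) #|{ffun 'I_n -> bool}|.

Definition sign_measure : set (borel_Rinfty R) -> \bar R :=
  mseries sign_layer 0.

HB.instance Definition _ := Measure.on sign_measure.

Lemma sum_enum (T : finType) (x0 : T) (F : T -> \bar R) :
  (\sum_(i < #|T|) F (nth x0 (enum T) i) = \sum_x F x)%E.
Proof.
rewrite -[RHS](big_enum _ _ T) (big_nth x0) big_mkord cardE.
by apply: eq_bigl.
Qed.

Lemma integral_sign_measure (g : borel_Rinfty R -> R) :
  (forall t, cube t -> 0 <= g t) ->
  measurable_fun (@cube R) (fun t => (g t)%:E) ->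
  (\int[sign_measure]_(t in @cube R) (g t)%:E =
   \sum_(0 <= n <oo)
      ((19 / 45) ^+ n * \sum_(e : {ffun 'I_n -> bool}) g (sign_point e))%:E)%E.
Proof.
move=> g0 mg.
have g0E t : cube t -> (0 <= (g t)%:E)%E by rewrite lee_fin; exact: g0.
have mc := @measurable_cube R.
rewrite ge0_integral_measure_series//; apply: eq_eseriesr => n _.
rewrite ge0_integral_measure_sum// mulr_sumr -sumEFin.
rewrite -(sum_enum [ffun=> false]); apply: eq_bigr => i _.
rewrite ge0_integral_mscale// integral_dirac// diracE mem_set ?mul1e//.
exact: sign_point_cube.
Qed.

Lemma sign_measure_setC_cube : sign_measure (~` @cube R) = 0%E.
Proof.
apply: eseries0 => n _ _; apply: big1 => i _; rewrite /sign_atom /= /mscale /=.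
rewrite diracE memNset ?mule0// => /(_ _)[].
exact: sign_point_cube.
Qed.

(** A bound by 1 on every nu_n, without the factor (19 / 20) ^ n, becomes the
    bound \sum_n (19 / 20) ^ n = 20 on the whole measure. *)
Lemma integral_sign_measure_le (c : R) (g : borel_Rinfty R -> R) : 0 <= c ->
  (forall t, cube t -> 0 <= g t) ->
  measurable_fun (@cube R) (fun t => (g t)%:E) ->
  (forall n, c * ((4 / 9) ^+ n
      * \sum_(e : {ffun 'I_n -> bool}) g (sign_point e)) <= 1) ->
  (c%:E * \int[sign_measure]_(t in @cube R) (g t)%:E <= 20%:E)%E.
Proof.
move=> c0 g0 mg le1; rewrite integral_sign_measure// -nneseriesZl; last first.
  move=> n _; rewrite lee_fin mulr_ge0 ?weight_ge0// sumr_ge0// => e _.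
  exact/g0/sign_point_cube.
have r1 : `|19 / 20 : R| < 1 by rewrite ger0_norm; lra.
apply: (@le_trans _ _ (\sum_(0 <= n <oo) ((19 / 20 : R) ^+ n)%:E)%E).
  apply: lee_nneseries => n _.
    rewrite -EFinM lee_fin mulr_ge0// mulr_ge0 ?weight_ge0// sumr_ge0// => e _.
    exact/g0/sign_point_cube.
  rewrite -EFinM lee_fin.
  have -> : 19 / 45 = 19 / 20 * (4 / 9) :> R by field.
  rewrite exprMn -[leRHS]mulr1 -!mulrA mulrCA ler_wpM2l//.
rewrite (_ : (fun _ => _) = EFin \o series (geometric 1 (19 / 20 : R))).
  have cg := @cvg_geometric_series R 1 _ r1.
  rewrite EFin_lim; last by apply/cvg_ex; eexists; exact: cg.
  have e20 : 1 / (1 - 19 / 20) = 20 :> R by field.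
  by rewrite (cvg_lim _ cg)// e20.
apply/funext => n /=; rewrite sumEFin; congr EFin.
by apply: eq_bigr => i _; rewrite /= mul1r.
Qed.

Lemma card_ffun_bool n : #|{ffun 'I_n -> bool}| = (2 ^ n)%N.
Proof. by rewrite card_ffun card_bool card_ord. Qed.

(** The function 1 has nu_n-integral (8 / 9) ^ n <= 1. *)
Lemma fin_num_sign_measure : fin_num_fun sign_measure.
Proof.
apply: lty_fin_num_fun; rewrite -(setvU (@cube R)).
have mc := @measurable_cube R.
rewrite measureU ?setICl//; last exact: measurableC.
rewrite [X in (X + _)%E]sign_measure_setC_cube add0e.
rewrite -[X in (X < _)%E]mul1e -integral_cst// -[X in (X < _)%E]mul1e.
apply: (@le_lt_trans _ _ 20%:E); last exact: ltry.
apply: integral_sign_measure_le => // n.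
rewrite sumr_const card_ffun_bool mul1r natrX -exprMn.
by apply: exprn_ile1; lra.
Qed.

HB.instance Definition _ :=
  Measure_isFinite.Build _ _ _ sign_measure fin_num_sign_measure.

End SignMeasure.

Arguments sign_point {R n} e.

(** * The test on reproducing kernels *)

Section KernelTest.
Context (R : realType).
Local Notation node := (node R).

(** With a = 1 - p s, b = 1 + p s and u = s ^ 2 / 2, one has a b = 1 - u and
    a ^ 2 + b ^ 2 = 2 + 2 u, so that the claim reads
    4 / 9 * (1 - 2 u) * (2 + 2 u) <= (1 - u) ^ 2; the difference of the two sides
    is the square of (1 - 5 u) / 3. The mass 4 / 9 is thus the largest possible
    one, with equality at s ^ 2 = 2 / 5. *)
Lemma one_variable_kernel_test (s : R) : -1 < s < 1 ->
  4 / 9 * \sum_(b : bool)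
    (1 - s ^+ 2) * `|(1 - (-1) ^+ b * node * s)^-1| ^+ 2 <= 1.
Proof.
move=> s1; rewrite big_bool /= expr0 expr1 mulN1r mul1r mulNr opprK.
have := node_itv R; have := node_sqr R; move: node => p p2 p1.
have a0 : 0 < 1 - p * s by nra.
have b0 : 0 < 1 + p * s by nra.
rewrite !ger0_norm ?invr_ge0 ?(ltW a0) ?(ltW b0)// -mulrDr.
set a := 1 - p * s in a0 *; set b := 1 + p * s in b0 *.
have ab : a * b = 1 - s ^+ 2 / 2.
  by rewrite -[_ / 2]mulrC -p2 /a /b; ring.
have aabb : a ^+ 2 + b ^+ 2 = 2 + s ^+ 2.
  have -> : a ^+ 2 + b ^+ 2 = 2 + 2 * (p ^+ 2 * s ^+ 2) by rewrite /a /b; ring.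
  by rewrite p2 mulrA divff ?mul1r.
have -> : (b^-1) ^+ 2 + (a^-1) ^+ 2 = (2 + s ^+ 2) / (a * b) ^+ 2.
  by rewrite -aabb; field; rewrite !gt_eqF.
rewrite !mulrA ler_pdivrMr ?exprn_gt0 ?mulr_gt0// mul1r ab -subr_ge0.
have -> : (1 - s ^+ 2 / 2) ^+ 2 - 4 / 9 * (1 - s ^+ 2) * (2 + s ^+ 2) =
  ((1 - 5 * (s ^+ 2 / 2)) / 3) ^+ 2 by field.
exact: sqr_ge0.
Qed.

(** Replaces the d factors of the kernel by n factors, one for each sign: the
    factors in coordinates j >= n, where the atom vanishes, are 1 - s_j ^ 2 <= 1
    and can be dropped, while those in coordinates j >= d are taken to be 1. *)
Lemma kernel_test_sign_point (d n : nat) (s : borel_Rinfty R)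
    (e : {ffun 'I_n -> bool}) : cube s ->
  \prod_(j < d) (1 - s j ^+ 2) * `|kernel_K d (sign_point e) s| ^+ 2 <=
  \prod_(i < n) (if (i < d)%N then
    (1 - s i ^+ 2) * `|(1 - (-1) ^+ e i * node * s i)^-1| ^+ 2 else 1).
Proof.
move=> cs.
pose F j := if (j < d)%N then
  (1 - s j ^+ 2) * `|(1 - sign_point e j * s j)^-1| ^+ 2 else 1.
have s2 j : 0 <= 1 - s j ^+ 2 by have := cs j; nra.
have F0 j : 0 <= F j.
  by rewrite /F; case: ifP => // _; rewrite mulr_ge0// sqr_ge0.
have -> : \prod_(j < d) (1 - s j ^+ 2) * `|kernel_K d (sign_point e) s| ^+ 2
    = \prod_(j < d) F j.
  rewrite /kernel_K normr_prod -prodrXl -big_split; apply: eq_bigr => j _ /=.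
  by rewrite /F ltn_ord.
(* The range j < d + n contains j < d and j < n: it is cut at d here, at n below. *)
have -> : \prod_(j < d) F j = \prod_(0 <= j < d + n) F j.
  rewrite (@big_cat_nat _ _ _ d)//= ?leq_addr// big_mkord.
  rewrite [X in _ * X]big_nat_cond [X in _ * X]big1 ?mulr1// => j.
  by rewrite andbT => /andP[dj _]; rewrite /F ltnNge dj.
have -> : \prod_(i < n) (if (i < d)%N then
    (1 - s i ^+ 2) * `|(1 - (-1) ^+ e i * node * s i)^-1| ^+ 2 else 1) =
    \prod_(0 <= j < n) F j.
  by rewrite big_mkord; apply: eq_bigr => i _; rewrite /F sign_point_lt.
rewrite (@big_cat_nat _ _ _ n)//= ?leq_addl// ler_piMr ?prodr_ge0//.
rewrite big_nat_cond; apply: prodr_ile1 => j; rewrite andbT => /andP[nj _].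
rewrite F0 /F /=; case: ifP => // _.
by rewrite sign_point_ge// mul0r subr0 invr1 normr1 expr1n mulr1; have := cs j; nra.
Qed.

(** After [kernel_test_sign_point] the sum over the sign vectors of a product
    over the coordinates is a product of n sums over one sign, each at most 1. *)
Lemma sign_layer_kernel_test (d n : nat) (s : borel_Rinfty R) : cube s ->
  \prod_(j < d) (1 - s j ^+ 2) * ((4 / 9) ^+ n *
    \sum_(e : {ffun 'I_n -> bool}) `|kernel_K d (sign_point e) s| ^+ 2) <= 1.
Proof.
move=> cs; rewrite mulrCA mulr_sumr.
have w0 : 0 <= (4 / 9 : R) by lra.
apply: (@le_trans _ _ ((4 / 9) ^+ n * \sum_(e : {ffun 'I_n -> bool})
    \prod_(i < n) (if (i < d)%N then
      (1 - s i ^+ 2) * `|(1 - (-1) ^+ e i * node * s i)^-1| ^+ 2 else 1))).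
  rewrite ler_wpM2l ?exprn_ge0//; apply: ler_sum => e _.
  exact: kernel_test_sign_point.
rewrite -(bigA_distr_bigA (fun (i : 'I_n) (b : bool) => if (i < d)%N then
    (1 - s i ^+ 2) * `|(1 - (-1) ^+ b * node * s i)^-1| ^+ 2 else 1)).
rewrite -[n in _ ^+ n]card_ord -prodr_const -big_split /=.
apply: prodr_ile1 => i _; have s2 : 0 <= 1 - s i ^+ 2 by have := cs i; nra.
case: (i < d)%N; last by rewrite big_bool /=; lra.
rewrite one_variable_kernel_test// andbT mulr_ge0// sumr_ge0// => b _.
by rewrite mulr_ge0// sqr_ge0.
Qed.

Lemma sign_measure_kernel_test (d : nat) (s : borel_Rinfty R) : cube s ->
  ((\prod_(j < d) (1 - s j ^+ 2))%:E * \int[@sign_measure R]_(t in @cube R)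
     (`|kernel_K d t s| ^+ 2)%:E <= 20%:E)%E.
Proof.
move=> cs; apply: integral_sign_measure_le.
- by apply: prodr_ge0 => j _; have := cs j; nra.
- by move=> t _; exact: sqr_ge0.
- exact: measurable_kernel.
- by move=> n; exact: sign_layer_kernel_test.
Qed.

End KernelTest.

(** * The polynomials violating the Carleson condition *)

Section TensorPower.
Context (R : realType).

Lemma modulus_real (x : R) : modulus x%:C%C = `|x|.
Proof. by rewrite /modulus /= expr0n addr0 sqrtr_sqr. Qed.

Lemma H2_norm_sq_infpoly (f : infpoly R) :
  H2_norm_sq f = (\sum_(k <- finsupp f) modulus (f k) ^+ 2)%:E.
Proof.
rewrite /H2_norm_sq -sumEFin fsbig_seq ?fset_uniq// -esum_fset//; last first.
  by move=> k _; rewrite lee_fin sqr_ge0.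
rewrite [RHS]esum_mkcond; apply: eq_esum => k _.
case: ifPn => // /negP; rewrite inE /= => /negP kf.
by rewrite (fsfun_dflt kf) -[0]/(0%:C%C) modulus_real normr0 expr0n.
Qed.

Lemma monomial_ord (A : comNzRingType) (z : nat -> A) (k : multiindex) n :
  (forall j, (n <= j)%N -> k j = 0%N) ->
  monomial z k = \prod_(i < n) z i ^+ k i.
Proof.
move=> kn; rewrite -(big_mkord xpredT (fun i => z i ^+ k i)) /monomial.
rewrite (perm_big [seq j <- index_iota 0 n | j \in finsupp k]).
  rewrite big_filter big_mkcond; apply: eq_bigr => j _ /=.
  by case: finsuppP => //; rewrite expr0.
apply: uniq_perm; rewrite ?fset_uniq ?filter_uniq ?iota_uniq// => j.
rewrite mem_filter mem_index_iota andbC; case: (ltnP j n) => //= /kn.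
by rewrite mem_finsupp => ->; rewrite eqxx.
Qed.

(** The exponents of the monomials of f_n = \prod_(i < n) (2 + z_i ^ 2): from each
    factor, a selects z_i ^ 2 or 2. *)
Definition square_exponent n (a : {ffun 'I_n -> bool}) : multiindex :=
  [fsfun j in [fset k in iota 0 n]%fset =>
     if insub j is Some i then (a i).*2 else 0%N].

Lemma square_exponent_lt n (a : {ffun 'I_n -> bool}) (i : 'I_n) :
  square_exponent a i = (a i).*2.
Proof. by rewrite fsfunE !inE mem_iota /= ltn_ord valK. Qed.

Lemma square_exponent_ge n (a : {ffun 'I_n -> bool}) j :
  (n <= j)%N -> square_exponent a j = 0%N.
Proof. by move=> nj; rewrite fsfunE !inE mem_iota /= ltnNge nj. Qed.

Lemma square_exponent_inj n : injective (@square_exponent n).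
Proof.
move=> a b ab; apply/ffunP => i.
have := congr1 (fun k : multiindex => k i) ab.
by rewrite !square_exponent_lt; case: (a i); case: (b i).
Qed.

(** The polynomial f_n in expanded form: the coefficient of a monomial collects a
    factor 2 for each variable that does not occur in it. *)
Definition tensor_power n : infpoly R :=
  [fsfun k in [fset square_exponent a | a in {ffun 'I_n -> bool}]%fset =>
     \prod_(i < n) (if k i == 0%N then 2 else 1)].

Lemma tensor_powerE n (a : {ffun 'I_n -> bool}) :
  tensor_power n (square_exponent a) =
  (\prod_(i < n) (if a i then 1 else 2))%:C%C.
Proof.
rewrite fsfunE in_imfset// rmorph_prod; apply: eq_bigr => i _.
by rewrite square_exponent_lt; case: (a i) => //=; rewrite ?rmorph1 // rmorph_nat.
Qed.

Lemma finsupp_tensor_power n :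
  finsupp (tensor_power n) =
  [fset square_exponent a | a in {ffun 'I_n -> bool}]%fset.
Proof.
apply/eqP; rewrite eqEfsubset finsupp_sub /=; apply/fsubsetP => k.
move=> /imfsetP[/= a _ ->]; rewrite mem_finsupp tensor_powerE.
rewrite fmorph_eq0; apply/prodf_neq0 => i _.
by case: (a i); rewrite ?oner_neq0 ?pnatr_eq0.
Qed.

Lemma sum_finsupp_tensor_power (V : nmodType) n (F : multiindex -> V) :
  \sum_(k <- finsupp (tensor_power n)) F k =
  \sum_(a : {ffun 'I_n -> bool}) F (square_exponent a).
Proof.
rewrite finsupp_tensor_power big_imfset/=.
  by rewrite big_enum.
by move=> a b _ _; exact: square_exponent_inj.
Qed.

(** The squared norm is multiplicative on products in separate variables: it is
    the sum over a of products of 1 or 4, hence (1 + 4) ^ n. *)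
Lemma H2_norm_sq_tensor_power n : H2_norm_sq (tensor_power n) = (5 ^+ n)%:E.
Proof.
rewrite H2_norm_sq_infpoly sum_finsupp_tensor_power; congr EFin.
under eq_bigr => a _ do
  rewrite tensor_powerE modulus_real real_normK ?num_real// -prodrXl.
rewrite -(bigA_distr_bigA
  (fun (_ : 'I_n) (b : bool) => (if b then 1 else 2 : R) ^+ 2)).
under eq_bigr => i _ do rewrite big_bool /=.
by rewrite prodr_const card_ord; congr (_ ^+ _); ring.
Qed.

Lemma eval_tensor_power n (t : nat -> R) :
  eval_infpoly (tensor_power n) (fun j => (t j)%:C%C) =
  (\prod_(i < n) (2 + t i ^+ 2))%:C%C.
Proof.
rewrite /eval_infpoly sum_finsupp_tensor_power.
have -> : \prod_(i < n) (2 + t i ^+ 2) =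
    \prod_(i < n) \sum_(b : bool) (if b then t i ^+ 2 else 2).
  by apply: eq_bigr => i _; rewrite big_bool /= addrC.
rewrite bigA_distr_bigA /= rmorph_sum; apply: eq_bigr => a _.
rewrite tensor_powerE (@monomial_ord _ _ _ n); last exact: square_exponent_ge.
rewrite !rmorph_prod -big_split; apply: eq_bigr => i _ /=.
rewrite square_exponent_lt; case: (a i) => /=.
  by rewrite rmorph1 mul1r rmorphXn.
by rewrite expr0 mulr1.
Qed.

(** The layer n alone suffices: it has 2 ^ n atoms of mass (19 / 45) ^ n, at each
    of which f_n takes the value (5 / 2) ^ n, and
    19 / 45 * 2 * 25 / 4 = 95 / 18. *)
Lemma integral_tensor_power_ge n :
  (((95 / 18) ^+ n)%:E <= \int[@sign_measure R]_(t in @cube R)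
    (modulus (eval_infpoly (tensor_power n) (fun j => (t j)%:C%C)) ^+ 2)%:E)%E.
Proof.
pose g (t : borel_Rinfty R) : R := (\prod_(i < n) (2 + t i ^+ 2)) ^+ 2.
have g0 t : 0 <= g t by exact: sqr_ge0.
rewrite (_ : (fun _ => _) = fun t => (g t)%:E); last first.
  by apply/funext => t; rewrite eval_tensor_power modulus_real real_normK ?num_real.
rewrite integral_sign_measure//; last first.
  apply/measurable_EFinP; apply: measurable_funX; apply: measurable_prod => i _.
  apply: measurable_funD => //; apply: measurable_funX; exact: measurable_coord.
have t0 k : (0 <= ((19 / 45) ^+ k *
    \sum_(e : {ffun 'I_k -> bool}) g (sign_point e))%:E)%E.
  by rewrite lee_fin mulr_ge0 ?weight_ge0// sumr_ge0.
apply: le_trans (@nneseries_lim_ge R _ xpredT 0 n.+1 (fun k _ _ => t0 k)).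
rewrite big_nat_recr//= -[leLHS]add0e leeD ?sume_ge0// lee_fin.
have gE (e : {ffun 'I_n -> bool}) : g (sign_point e) = (25 / 4) ^+ n.
  have -> : 25 / 4 = (5 / 2) ^+ 2 :> R by field.
  rewrite -exprM mulnC exprM /g; congr (_ ^+ _).
  rewrite -[n in RHS]card_ord -prodr_const; apply: eq_bigr => i _.
  by rewrite sign_point_lt exprMn sqrr_sign mul1r node_sqr; field.
under eq_bigr => e _ do rewrite gE.
rewrite sumr_const card_ffun_bool -[_ *+ (2 ^ n)]mulr_natr natrX -!exprMn.
by rewrite le_eqVlt; apply/orP; left; apply/eqP; congr (_ ^+ _); field.
Qed.

End TensorPower.

Theorem propositionA3 (R : realType) :
  exists mu : {finite_measure set (borel_Rinfty R) -> \bar R},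
    [/\ concentrated_on mu (@cube R),
        (ereal_sup
          [set x : \bar R | exists (s : borel_Rinfty R) (d : nat),
             [/\ @cube R s, (1 <= d)%N &
              x = ((\prod_(j < d) (1 - s j ^+ 2))%:E
                   * \int[mu]_(t in @cube R)
                       (`|kernel_K d t s| ^+ 2)%:E)%E]]
          < +oo)%E
      & ~ is_carleson mu].
Proof.
exists (@sign_measure R); split.
- by split; [exact: measurable_cube | exact: sign_measure_setC_cube].
- apply: (@le_lt_trans _ _ 20%:E); last exact: ltry.
  apply: ge_ereal_sup => _ [s [d [cs _ ->]]].
  exact: sign_measure_kernel_test.
- move=> [C C0 carleson].
  (* An n with (18 / 19) ^ n < C^-1, that is C < (19 / 18) ^ n. *)
  have r1 : `|18 / 19 : R| < 1 by rewrite ger0_norm; lra.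
  have /cvgrPdist_lt /(_ C^-1) := cvg_geometric 1 r1.
  rewrite invr_gt0 => /(_ C0)[n _ /(_ n (leqnn n))].
  rewrite /geometric /= mul1r sub0r normrN ger0_norm ?exprn_ge0; [|lra..].
  apply/negP; rewrite -leNgt.
  have := le_trans (integral_tensor_power_ge R n) (carleson (tensor_power R n)).
  rewrite H2_norm_sq_tensor_power -EFinM lee_fin => le5.
  (* The bound (95 / 18) ^ n <= C * 5 ^ n is divided by (95 / 18) ^ n. *)
  rewrite -(ler_pM2l C0) divff ?gt_eqF//.
  have q0 : 0 < (18 / 95 : R) ^+ n by apply: exprn_gt0; lra.
  rewrite -(ler_pM2r q0) in le5; move: le5; rewrite -exprMn -[C * _ * _]mulrA -exprMn.
  have -> : 95 / 18 * (18 / 95) = 1 :> R by field.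
  have -> : 5 * (18 / 95) = 18 / 19 :> R by field.
  by rewrite expr1n.
Qed.
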